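(* Let $n\geq 5$ be an integer. Then there exist infinitely many triples $(a,b,c)$ of rational numbers such that the system of Diophantine equations \[ \sigma_{1}(x_{1},\ldots,x_{n})=a,\qquad \sigma_{2}(x_{1},\ldots,x_{n})=b,\qquad \sigma_{3}(x_{1},\ldots,x_{n})=c \] has infinitely many solutions $(x_{1},\ldots,x_{n})$ in rational numbers.
   Context: For $1\leq i\leq n$, $\sigma_{i}(x_{1},\ldots,x_{n})=\sum_{1\leq k_{1}<\cdots<k_{i}\leq n}x_{k_{1}}\cdots x_{k_{i}}$ denotes the $i$-th elementary symmetric polynomial. *)

(* Defs.v *)
From mathcomp Require Import all_boot all_order all_algebra.
From mathcomp Require Import mpoly.

Set Implicit Arguments.
Unset Strict Implicit.
Unset Printing Implicit Defensive.

Import GRing.Theory.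
Local Open Scope ring_scope.

(* A choice of indices k_1 < ... < k_i is a subset h of 'I_n of cardinal i. *)
Lemma meval_mesymE n i (x : n.-tuple rat) :
  (mesym n rat i).@[tnth x] =
    \sum_(h : {set 'I_n} | #|h| == i) \prod_(k in h) tnth x k.
Proof.
rewrite /mesym raddf_sum; apply: eq_bigr => h _ /=.
by rewrite rmorph_prod; apply: eq_bigr => k _ /=; rewrite mevalXU.
Qed.

(* Main.v *)
Require Import Defs.
From mathcomp Require Import all_boot all_order all_algebra.
From mathcomp Require Import classical_sets cardinality mpoly.
From mathcomp Require Import ring lra.
Local Open Scope ring_scope.
Local Open Scope classical_set_scope.

(** The monic polynomial with roots [u, -u, v, -v] and [m] zeros is
    [X^m (X^2 - u^2) (X^2 - v^2)], so by Vieta [sigma_1] and [sigma_3] of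
    these roots vanish while [sigma_2 = - (u^2 + v^2)]. Every circle
    [u^2 + v^2 = r^2] with [r] rational has infinitely many rational points;
    letting [r] vary gives infinitely many triples [(0, - r^2, 0)]. *)

Import GRing.Theory Num.Theory.

Lemma infinite_set_inj (T : Type) (A : set T) (f : nat -> T) :
  injective f -> (forall k, A (f k)) -> infinite_set A.
Proof.
move=> f_inj Af; apply: (@sub_infinite_set _ (range f)) => [_ [k _ <-] //|].
by rewrite (eq_finite_set (inj_card_eq (in2W f_inj))); exact: infinite_nat.
Qed.

Definition opp_pairs (R : zmodType) (m : nat) (u v : R) : m.+4.-tuple R :=
  [tuple of [:: u, - u, v, - v & nseq m 0]].

Arguments opp_pairs {R} m u v.

Lemma prod_opp_pairs (R : comNzRingType) (m : nat) (u v : R) :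
  \prod_(c <- opp_pairs m u v) ('X - c%:P) =
    ('X^4 - (u ^+ 2 + v ^+ 2) *: 'X^2 + (u * v) ^+ 2 *: 1) * 'X^m.
Proof.
(* The [m] zero roots give an iterated product of ['X], refolded here into the power ['X ^+ m]. *)
rewrite /= !big_cons big_nseq subr0 -Monoid.iteropE -/(_ ^+ m).
rewrite -!mul_polyC; ring.
Qed.

(** For [k <= 4], the factor ['X^m] moves the coefficient given by Vieta to degree [4 - k] of an
    even quartic, whose odd coefficients vanish. *)
Lemma mesym_opp_pairs (R : idomainType) (m : nat) (u v : R) :
  [/\ (mesym m.+4 R 1).@[tnth (opp_pairs m u v)] = 0,
      (mesym m.+4 R 2).@[tnth (opp_pairs m u v)] = - (u ^+ 2 + v ^+ 2) &
      (mesym m.+4 R 3).@[tnth (opp_pairs m u v)] = 0].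
Proof.
have sigmaE k : (k < m.+4.+1)%N ->
    (mesym m.+4 R k).@[tnth (opp_pairs m u v)] =
    (-1) ^+ k * (\prod_(c <- opp_pairs m u v) ('X - c%:P))`_(m.+4 - k).
  by move=> lt_k; rewrite (mroots_coeff _ (Ordinal lt_k)) signrMK.
have coef_sub k : (k <= 4)%N ->
    (\prod_(c <- opp_pairs m u v) ('X - c%:P))`_(m.+4 - k) =
    ('X^4 - (u ^+ 2 + v ^+ 2) *: 'X^2 + (u * v) ^+ 2 *: 1)`_(4 - k).
  move=> le_k4; rewrite prod_opp_pairs coefMXn -[m.+4]addn4 -addnBA //.
  by rewrite ltnNge leq_addr /= addKn.
by split; rewrite sigmaE // coef_sub // !coefE /=; ring.
Qed.

(** The slope-[k] rational parametrisation of the circle of radius [r]. *)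
Definition circle_point (F : fieldType) (r : F) (k : nat) : F * F :=
  let: d := 1 + k%:R ^+ 2 in
  (r * (1 - k%:R ^+ 2) / d, r * (2 * k%:R) / d).

Arguments circle_point {F} r k.

Lemma circle_denom_neq0 (F : realFieldType) (k : nat) :
  1 + k%:R ^+ 2 != 0 :> F.
Proof. by rewrite lt0r_neq0 // ltr_wpDr // sqr_ge0. Qed.

Lemma circle_pointP (F : realFieldType) (r : F) (k : nat) :
  (circle_point r k).1 ^+ 2 + (circle_point r k).2 ^+ 2 = r ^+ 2.
Proof. by have := circle_denom_neq0 F k; rewrite /= => d_neq0; field. Qed.

(** The abscissa is [r] times a Moebius function of [k ^ 2], hence determines [k ^ 2], and [k] is a
    natural number. *)
Lemma circle_point1_inj (F : realFieldType) (r : F) :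
  r != 0 -> injective (fun k => (circle_point r k).1).
Proof.
move=> r_neq0 k l /=.
have := circle_denom_neq0 F k; have := circle_denom_neq0 F l => dl dk.
move/eqP; rewrite eqr_div // -!mulrA (inj_eq (mulfI r_neq0)) => /eqP eq_kl.
(* After cross-multiplication the terms [k ^ 2 * l ^ 2] cancel, leaving a linear relation between
   the squares. *)
have : k%:R ^+ 2 = l%:R ^+ 2 :> F by lra.
by move/eqP; rewrite eqrXn2 // ?ler0n // eqr_nat => /eqP.
Qed.

Theorem theorem5 (n : nat) (hn : (5 <= n)%N) :
  infinite_set [set abc : rat * rat * rat | let: (a, b, c) := abc in
    infinite_set [set x : n.-tuple rat |
      [/\ (mesym n rat 1).@[tnth x] = a,
          (mesym n rat 2).@[tnth x] = b &
          (mesym n rat 3).@[tnth x] = c]]].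
Proof.
case: n hn => [|[|[|[|m]]]] // _.
(* The shift [r.+1] avoids radius 0, where the circle is a single point. *)
apply: (@infinite_set_inj _ _ (fun r => (0, - r.+1%:R ^+ 2, 0))) => [r s []|r].
  by move/oppr_inj/eqP; rewrite eqrXn2 ?ler0n // eqr_nat => /eqP [].
pose x k := let: (u, v) := circle_point (r.+1%:R : rat) k in opp_pairs m u v.
apply: (@infinite_set_inj _ _ x) => [k l|k] /=.
  (* The first entry [u] alone separates the tuples. *)
  move/(congr1 (head 0 \o val)) => /=; apply: circle_point1_inj.
  by rewrite pnatr_eq0.
by rewrite -(circle_pointP _ r.+1%:R k); exact: mesym_opp_pairs.
Qed.
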